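(* Let the location $x\in\mathbb{R}^2$ of the center and the capacities $\mu_j(\cdot)$ be fixed, let trucks have capacity $C\in(0,\infty)$ and speed $S\in(0,\infty)$, and assume that the demand can be satisfied with sufficiently many trucks, i.e. there is $N\ge 1$ with $C\cdot TH_w(N;x)\ge D$. Then the algorithm (A) described in the context stops after finitely many iterations and its output is the minimal number $N\ge1$ of trucks with $C\cdot TH_w(N;x)\ge D$.
   Context: Data: an integer $J\ge 2$; warehouses $j=2,\dots,J$ with locations $a_j\in\mathbb{R}^2$ and demands $D_j>0$ (in units of the commodity); $D=\sum_{j=2}^J D_j$, $\rho_j=D_j/D$; a convex function $d:\mathbb{R}^2\times\mathbb{R}^2\to[0,\infty)$, and $d_j(x):=d(a_j,x)$; for $j=1,\dots,J$ an integer $s_j\ge 1$ and a real $\mu_j>0$, with $\mu_j(n):=\mu_j\min(n,s_j)$. Node $1$ is the production center at $x\in\mathbb{R}^2$. Demands and throughputs refer to a common time unit. Network: $N\ge 1$ trucks circulate in a closed queueing network (Gordon–Newell network) with node set $\bar J=\{1,2,\dots,J,2a,\dots,Ja,2b,\dots,Jb\}$. Node $j\in\{1,\dots,J\}$ is a first-come-first-served exponential station with total service rate $\mu_j(n_j)$ when $n_j$ trucks are present. Nodes $ja$ and $jb$ ($j=2,\dots,J$) are infinite-server stations with exponential service times (travel times) of mean $d_j(x)/S$. All service times and routing decisions are independent. Routing: $r(1,ja)=\rho_j$, $r(ja,j)=r(j,jb)=r(jb,1)=1$ for $j=2,\dots,J$, all other $r(k,m)=0$. The queue length vector is a continuous-time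 Markov chain on $S(N,\bar J)=\{(n_i)_{i\in\bar J}\in\mathbb{N}^{\bar J}:\sum_i n_i=N\}$ which jumps from $n$ to $n-e_i+e_k$ (for $n_i\ge1$) at rate (total service rate of node $i$ at $n_i$) $\cdot\, r(i,k)$; $\pi(\cdot;x)$ is its unique stationary distribution. (If $d_j(x)=0$, travel on $ja,jb$ is instantaneous, and $n_{ja}=n_{jb}=0$ always.) $TH_w(N;x)=\sum_{j=2}^J\sum_{n\in S(N,\bar J)}\pi(n;x)\mu_j(n_j)$ is the stationary mean number of truck departures per time unit from the warehouses. Algorithm (A). Put $\eta_1=\tfrac14$, $\eta_j=\tfrac14\rho_j$ for $j=2,\dots,J$; $g_j(0)=1$, $g_j(m)=\prod_{k=1}^m \eta_j/\mu_j(k)$ for $m\ge 1$; $\kappa=2\sum_{j=2}^J\eta_jd_j(x)/S$; $G(0,j)=1$ for $j=1,\dots,J$; $H(1)=1$; $N=1$. Iterate: (1) set $G(N,1)=g_1(N)$ and compute $G(m,j)=\sum_{\ell=0}^m G(\ell,j-1)\,g_j(m-\ell)$ for $j=2,\dots,J$, $m\le N$, obtaining $G(0,J),\dots,G(N,J)$; (2) compute $G(N,\bar J;x)=\sum_{n=0}^N G(N-n,J)\,\kappa^n/n!$; (3) if $C\cdot\frac14\cdot H(N)/G(N,\bar J;x)\ge D$, output $N$ and stop; otherwise set $H(N+1)=G(N,\bar J;x)$, replace $N$ by $N+1$, and repeat. *)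

(* Defs.v *)
From HB Require Import structures.
From mathcomp Require Import all_boot all_order all_algebra.
From mathcomp Require Import boolp classical_sets reals convex.

Set Implicit Arguments.
Unset Strict Implicit.
Unset Printing Implicit Defensive.

Import Order.TTheory GRing.Theory Num.Theory.
Local Open Scope ring_scope.

(* Stations are numbered by natural numbers: 1 is the production center and   *)
(* 2, ..., J are the warehouses.  Each of the functions below is meaningful   *)
(* only on its own range (1..J for servers and srate, 2..J for the others).   *)
Record network (R : realType) := Network {
  nstations : nat;                         (* J *)
  location : nat -> 'rV[R]_2;              (* a_j *)
  demand : nat -> R;                       (* D_j *)
  dist : 'rV[R]_2 -> 'rV[R]_2 -> R;        (* d *)
  servers : nat -> nat;                    (* s_j *)
  srate : nat -> R                         (* the constant mu_j *)
}.

(* The node set {1, ..., J, 2a, ..., Ja, 2b, ..., Jb}; the ordinal j < J - 1  *)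
(* stands for the warehouse number j + 2.                                     *)
Inductive node (J : nat) : Type :=
  | Center
  | Warehouse of 'I_J.-1
  | Outward of 'I_J.-1       (* ja *)
  | Homeward of 'I_J.-1.     (* jb *)
Arguments Center {J}.
Arguments Warehouse {J} _.
Arguments Outward {J} _.
Arguments Homeward {J} _.

Definition node_code J (i : node J) : option ('I_J.-1 + ('I_J.-1 + 'I_J.-1)) :=
  match i with
  | Center => None
  | Warehouse j => Some (inl j)
  | Outward j => Some (inr (inl j))
  | Homeward j => Some (inr (inr j))
  end.

Definition node_decode J (c : option ('I_J.-1 + ('I_J.-1 + 'I_J.-1))) : node J :=
  match c with
  | None => Center
  | Some (inl j) => Warehouse j
  | Some (inr (inl j)) => Outward j
  | Some (inr (inr j)) => Homeward j
  end.

Lemma node_codeK J : cancel (@node_code J) (@node_decode J).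
Proof. by case. Qed.

HB.instance Definition _ J := Equality.copy (node J) (can_type (@node_codeK J)).
HB.instance Definition _ J := Choice.copy (node J) (can_type (@node_codeK J)).
HB.instance Definition _ J := Countable.copy (node J) (can_type (@node_codeK J)).
HB.instance Definition _ J := Finite.copy (node J) (can_type (@node_codeK J)).

(* S(N, Jbar) *)
Definition state (J N : nat) : Type :=
  {n : {ffun node J -> 'I_N.+1} | (\sum_i n i)%N == N}.
HB.instance Definition _ J N := Finite.copy (state J N)
  {n : {ffun node J -> 'I_N.+1} | (\sum_i n i)%N == N}.

Definition qlen J N (n : state J N) (i : node J) : nat := val n i.

(* n' = n - e_i + e_k and n_i >= 1 *)
Definition jump J N (n : state J N) (i k : node J) (n' : state J N) : bool :=
  (0 < qlen n i)%N &&
  [forall l, (qlen n' l + (l == i) == qlen n l + (l == k))%N].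

Section Model.
Context {R : realType}.
Variables (net : network R) (x : 'rV[R]_2) (speed : R).

Local Notation J := (nstations net).

Definition total_demand : R := \sum_(2 <= j < J.+1) demand net j.

Definition rho (j : nat) : R := demand net j / total_demand.

Definition dto (j : nat) : R := dist net (location net j) x.

Definition mu (j n : nat) : R := srate net j * (minn n (servers net j))%:R.

Definition routing (i k : node J) : R :=
  match i, k with
  | Center, Outward j => rho j.+2
  | Outward j, Warehouse j' => (j == j')%:R
  | Warehouse j, Homeward j' => (j == j')%:R
  | Homeward _, Center => 1
  | _, _ => 0
  end.

(* Travel nodes with zero mean travel time, which trucks cross instantly. *)
Definition instantaneous (i : node J) : bool :=
  match i with
  | Outward j | Homeward j => dto j.+2 == 0
  | _ => false
  end.

(* Routing with the instantaneous nodes eliminated: no two of them are        *)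
(* consecutive on a route, so at most one is crossed between two nodes.       *)
(* This is routing itself when there is no instantaneous node.                *)
Definition eff_routing (i k : node J) : R :=
  if instantaneous k then 0
  else routing i k + \sum_(l | instantaneous l) routing i l * routing l k.

(* For an instantaneous node this is 0 (since 0^-1 = 0), but such a node is   *)
(* never occupied, see stationary.                                            *)
Definition service_rate (i : node J) (n : nat) : R :=
  match i with
  | Center => mu 1 n
  | Warehouse j => mu j.+2 n
  | Outward j | Homeward j => n%:R / (dto j.+2 / speed)
  end.

Definition jump_rate N (n n' : state J N) : R :=
  \sum_i \sum_(k | jump n i k n') service_rate i (qlen n i) * eff_routing i k.

Definition generator N (n n' : state J N) : R :=
  if n == n' then - \sum_(m | m != n) jump_rate n m else jump_rate n n'.

Definition stationary N (p : {ffun state J N -> R}) : Prop :=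
  [/\ forall n, 0 <= p n,
      \sum_n p n = 1,
      forall n i, instantaneous i -> (0 < qlen n i)%N -> p n = 0
    & forall n', \sum_n p n * generator n n' = 0].

(* The stationary distribution pi(.; x). *)
Definition stationary_dist N : {ffun state J N -> R} :=
  xget [ffun=> 0] [set p | stationary p]%classic.

(* TH_w(N; x) *)
Definition throughput N : R :=
  \sum_(j < J.-1) \sum_n stationary_dist N n * mu j.+2 (qlen n (Warehouse j)).

Definition eta (j : nat) : R := if j == 1%N then 4%:R^-1 else 4%:R^-1 * rho j.

Definition gfac (j m : nat) : R := \prod_(1 <= k < m.+1) (eta j / mu j k).

Definition kappa : R := 2 * \sum_(2 <= j < J.+1) eta j * dto j / speed.

(* The memory of the algorithm: the current N, the entries G(., 1) and the    *)
(* entries H(.).  Entries that are not yet set hold 0.  The entries G(m, j)   *)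
(* with j >= 2 are recomputed in each iteration, so they are not stored.      *)
Record memory := Memory {
  curN : nat;
  memG1 : nat -> R;
  memH : nat -> R
}.

Definition init_memory : memory :=
  Memory 1 (fun m => (m == 0%N)%:R) (fun n => (n == 1%N)%:R).

(* G(m, j), computed from the first column G1 = G(., 1). *)
Fixpoint Gcol (G1 : nat -> R) (j m : nat) : R :=
  match j with
  | 0 | 1 => G1 m
  | j'.+1 => \sum_(l < m.+1) Gcol G1 j' l * gfac j (m - l)
  end.

(* One iteration: either an output, or the memory for the next iteration. *)
Definition step (C : R) (st : memory) : nat + memory :=
  let N := curN st in
  let G1 := [eta memG1 st with N |-> gfac 1 N] in
  let Gbar := \sum_(n < N.+1) Gcol G1 J (N - n) * (kappa ^+ n / n`!%:R) in
  if total_demand <= C * 4%:R^-1 * (memH st N / Gbar) then inl N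
  else inr (Memory N.+1 G1 [eta memH st with N.+1 |-> Gbar]).

(* The output of the algorithm if it stops within k iterations. *)
Fixpoint run (C : R) (k : nat) (st : memory) : option nat :=
  match k with
  | 0 => None
  | k'.+1 =>
    match step C st with
    | inl N => Some N
    | inr st' => run C k' st'
    end
  end.

End Model.

(* Main.v *)
(* The network is a Gordon-Newell network, and eta (extended to the travel nodes)
   solves its traffic equation, so the product of the station weights is balanced.
   The stationary law is unique: if p is stationary and q is the product form, let
   c be the minimum of p / q; then p - c q is nonnegative, balanced and vanishes
   somewhere, and zeros propagate backwards along jumps to all feasible states.
   The normalizing constant for N trucks is a coefficient of a product of
   generating polynomials, which is the convolution G(N) computed by the algorithm
   (the exponential factors of the travel nodes merge into the one with parameter
   kappa).  Multiplying by mu_j shifts the polynomial of warehouse j by one degree,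
   hence TH_w(N) = (1/4) G(N-1) / G(N): the test of step (3) is exactly
   C TH_w(N) >= D, and the algorithm performs a linear search for the first N that
   satisfies it.  A travel node with zero travel time has weight 0^n / n!, which
   excludes the states where it is occupied. *)
Require Import Defs.
From mathcomp Require Import all_boot all_order all_algebra.
From mathcomp Require Import boolp classical_sets reals convex.
From mathcomp Require Import zify ring.
Set Implicit Arguments.
Unset Strict Implicit.
Unset Printing Implicit Defensive.

Import Order.TTheory GRing.Theory Num.Theory.
Local Open Scope ring_scope.

(** * Generating polynomials *)

Lemma big_node (T : Type) (idx : T) (op : Monoid.com_law idx) (J : nat)
    (F : node J -> T) :
  \big[op/idx]_i F i =
  op (op (F Center) (\big[op/idx]_j F (Warehouse j)))
     (\big[op/idx]_j op (F (Outward j)) (F (Homeward j))).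
Proof.
rewrite (reindex (@node_decode J)); last first.
  by apply: onW_bij; exists (@node_code J) => //; [case=> [[|[]]|] | exact: node_codeK].
rewrite (bigD1 None) //= -Monoid.mulmA; congr (op _ _).
rewrite (reindex_omap (op := op) Some id) /=; last by case.
under eq_bigl do rewrite eqxx.
by rewrite !big_sumType big_split.
Qed.

(** Expanding the product picks one monomial per factor; a choice [f] reaches degree [N] exactly
    when its exponents sum to [N]. *)
Lemma coef_prod_poly (K : comNzRingType) (I : finType) (N : nat)
    (w : I -> nat -> K) :
  (\prod_i \poly_(m < N.+1) w i m)`_N =
  \sum_(f : {ffun I -> 'I_N.+1} | (\sum_i f i)%N == N) \prod_i w i (f i).
Proof.
under eq_bigr do rewrite poly_def.
rewrite bigA_distr_bigA coef_sum [RHS]big_mkcond /=; apply: eq_bigr => f _.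
rewrite scaler_prod prodrXr coefZ coefXn eq_sym.
by case: eqP; rewrite ?mulr1 ?mulr0.
Qed.

(** Multiplying exponential series adds their parameters; truncation at [L] leaves the coefficients
    below [L] intact. *)
Lemma coef_prod_exp_poly (K : numFieldType) (I : Type) (s : seq I) (a : I -> K)
    (L m : nat) : (m < L)%N ->
  (\prod_(i <- s) \poly_(l < L) (a i ^+ l / l`!%:R))`_m =
  (\sum_(i <- s) a i) ^+ m / m`!%:R.
Proof.
elim: s m => [|i s IH] m ltmL.
  by rewrite !big_nil coef1 expr0n; case: m ltmL => [|m] _; rewrite ?divr1 ?mul0r.
(* [coefMr] orders the convolution so that it matches the binomial expansion term by term. *)
rewrite !big_cons coefMr exprDn mulr_suml; apply: eq_bigr => j _.
have lejm : (j <= m)%N by rewrite -ltnS.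
rewrite IH ?(leq_ltn_trans lejm) // coef_poly (leq_ltn_trans (leq_subr _ _) ltmL).
have fact_neq0 k : k`!%:R != 0 :> K by rewrite pnatr_eq0 -lt0n fact_gt0.
have binE : 'C(m, j)%:R = m`!%:R / (j`!%:R * (m - j)`!%:R) :> K.
  by rewrite -(bin_fact lejm) !natrM mulfK ?mulf_neq0.
rewrite -[_ *+ 'C(_, _)]mulr_natr binE.
by field; rewrite !fact_neq0.
Qed.

(** Each further column of [Gcol] is a convolution with [gfac], that is, one more polynomial
    factor. *)
Lemma coef_prod_gfac (R : realType) (net : network R) (k L m : nat) : (m < L)%N ->
  (\prod_(1 <= j < k.+2) \poly_(l < L) gfac net j l)`_m =
  Gcol net (gfac net 1) k.+1 m.
Proof.
elim: k m => [|k IH] m ltmL; first by rewrite big_nat1 coef_poly ltmL.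
rewrite big_nat_recr //= coefM; apply: eq_bigr => l _.
have lelm : (l <= m)%N by rewrite -ltnS.
by rewrite IH ?(leq_ltn_trans lelm) // coef_poly (leq_ltn_trans (leq_subr _ _) ltmL).
Qed.

Lemma sum_state (V : nmodType) (J N : nat) (F : {ffun node J -> 'I_N.+1} -> V) :
  \sum_(n : state J N) F (val n) =
  \sum_(f : {ffun node J -> 'I_N.+1} | (\sum_i f i)%N == N) F f.
Proof.
rewrite [RHS](reindex_omap (op := +%R) (val : state J N -> _) insub) /=.
  by apply: eq_bigl => n; rewrite (valP n) valK eqxx.
by move=> f hf; rewrite insubT.
Qed.

(** * States and jumps *)

Lemma sum_nat_delta (I : finType) (i : I) : (\sum_l (l == i))%N = 1%N.
Proof. by rewrite (bigD1 i) //= eqxx big1 // => l /negPf->. Qed.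

Section States.
Variables J N : nat.
Implicit Types (n m : state J N) (i k l : node J).

Lemma qlen_inj n m : qlen n =1 qlen m -> n = m.
Proof. by move=> eq_nm; apply/val_inj/ffunP => i; apply/val_inj/eq_nm. Qed.

Lemma sum_qlen n : (\sum_i qlen n i)%N = N.
Proof. exact/eqP/(valP n). Qed.

Lemma state_exists (f : node J -> nat) :
  (\sum_i f i)%N = N -> exists n, qlen n =1 f.
Proof.
move=> sumf.
have ltf i : (f i < N.+1)%N by rewrite ltnS -sumf (bigD1 i) //= leq_addr.
pose F : {ffun node J -> 'I_N.+1} := [ffun i => Ordinal (ltf i)].
have FE i : F i = f i :> nat by rewrite ffunE.
have sumF : (\sum_i F i)%N == N.
  by rewrite -[X in _ == X]sumf; apply/eqP/eq_bigr => i _; rewrite FE.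
by exists (exist _ F sumF) => i; exact: FE.
Qed.

Lemma jumpP n i k m :
  reflect ((0 < qlen n i)%N /\
           forall l, (qlen m l + (l == i) = qlen n l + (l == k))%N)
          (jump n i k m).
Proof.
apply: (iffP andP) => -[n_i Enm]; split=> //.
  by move=> l; apply/eqP/(forallP Enm).
by apply/forallP => l; apply/eqP.
Qed.

Lemma jump_exists n i k : (0 < qlen n i)%N -> exists m, jump n i k m.
Proof.
move=> n_i; pose f l := (qlen n l + (l == k) - (l == i))%N.
have fE l : (f l + (l == i) = qlen n l + (l == k))%N.
  by rewrite subnK //; case: eqP => // ->; rewrite ltn_addr.
have [|m mE] := @state_exists f.
  have: (\sum_l (f l + (l == i)) = \sum_l (qlen n l + (l == k)))%N.
    exact: eq_bigr.
  by rewrite !big_split /= !sum_nat_delta sum_qlen => /addIn.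
by exists m; apply/jumpP; split=> // l; rewrite mE fE.
Qed.

Lemma jump_inj n i k m m' : jump n i k m -> jump n i k m' -> m = m'.
Proof.
move=> /jumpP[_ Em] /jumpP[_ Em']; apply: qlen_inj => l.
by apply/eqP; rewrite -(eqn_add2r (l == i)) Em Em'.
Qed.

Lemma jump_sym n i k m : jump n i k m = jump m k i n.
Proof.
have sub n' i' k' m' : jump n' i' k' m' -> jump m' k' i' n'.
  move=> /jumpP[n_i E]; apply/jumpP; split=> [|l]; last by rewrite E.
  have := E k'; rewrite eqxx; case: eqP => [ki _|_]; last by lia.
  by have := E i'; rewrite ki eqxx; lia.
by apply/idP/idP; exact: sub.
Qed.

Lemma jumpnn n i m : jump n i i m -> n = m.
Proof. by move=> /jumpP[_ E]; apply: qlen_inj => l; have := E l; lia. Qed.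

Lemma sum_jump (V : nmodType) n i k (a : V) :
  \sum_(m | jump n i k m) a = a *+ (0 < qlen n i)%N.
Proof.
have [n_i|n_i] := ltnP 0 (qlen n i); last first.
  by apply: big_pred0 => m; rewrite /jump ltnNge n_i.
have [m nm] := jump_exists k n_i.
rewrite (big_pred1 m) // => m'; apply/idP/eqP => [nm'|->//].
exact: jump_inj nm' nm.
Qed.

End States.

(** * Rates, visit ratios and the traffic equation *)

Section Network.
Variables (R : realType) (net : network R) (x : 'rV[R]_2) (speed : R).
Local Notation J := (nstations net).
Hypotheses
  (hJ : (2 <= J)%N)
  (hD : forall j : nat, (2 <= j <= J)%N -> 0 < demand net j)
  (hd0 : forall a y : 'rV[R]_2, 0 <= dist net a y)
  (hs : forall j : nat, (1 <= j <= J)%N -> (1 <= servers net j)%N)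
  (hmu : forall j : nat, (1 <= j <= J)%N -> 0 < srate net j)
  (hspeed : 0 < speed).

Implicit Types (j : 'I_J.-1) (i k l : node J).

Local Notation inst := (instantaneous x).
Local Notation srv := (service_rate x speed).
Local Notation eff := (eff_routing x).

Lemma warehouse_range j : (2 <= j.+2 <= J)%N.
Proof. by have := ltn_ord j; lia. Qed.

Lemma station_range j : (1 <= j.+2 <= J)%N.
Proof. by have := ltn_ord j; lia. Qed.

Lemma big_warehouse (T : Type) (idx : T) (op : Monoid.law idx) (F : nat -> T) :
  \big[op/idx]_(2 <= j < J.+1) F j = \big[op/idx]_(j < J.-1) F j.+2.
Proof.
rewrite -[2%N]add0n big_addn big_mkord.
have -> : (J.+1 - 2 = J.-1)%N by lia.
by apply: eq_bigr => j _; rewrite addn2.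
Qed.

Lemma demand_total_gt0 : 0 < total_demand net.
Proof.
rewrite /total_demand big_warehouse.
have j0 : (0 < J.-1)%N by lia.
rewrite (bigD1 (Ordinal j0)) //= ltr_pwDl ?hD //.
by apply: sumr_ge0 => j _; apply/ltW/hD/warehouse_range.
Qed.

Lemma rho_gt0 j : 0 < rho net j.+2.
Proof. by rewrite divr_gt0 ?demand_total_gt0 ?hD ?warehouse_range. Qed.

Lemma sum_rho : \sum_(j < J.-1) rho net j.+2 = 1.
Proof.
rewrite -(big_warehouse _ (rho net)) -mulr_suml divff //.
exact/lt0r_neq0/demand_total_gt0.
Qed.

(** Normalized to total 1: each of the four kinds of node carries one quarter. *)
Definition visit_ratio i : R :=
  match i with
  | Center => eta net 1
  | Warehouse j | Outward j | Homeward j => eta net j.+2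
  end.

Definition weight i m : R :=
  match i with
  | Center => gfac net 1 m
  | Warehouse j => gfac net j.+2 m
  | Outward j | Homeward j => (eta net j.+2 * dto net x j.+2 / speed) ^+ m / m`!%:R
  end.

Lemma visit_ratio_gt0 i : 0 < visit_ratio i.
Proof.
have eta_gt0 j : 0 < eta net j.+2 by rewrite /eta /= mulr_gt0 ?rho_gt0 ?invr_gt0.
by case: i => //=; rewrite /eta /= invr_gt0.
Qed.

Lemma mu_gt0 n m : (1 <= n <= J)%N -> 0 < mu net n m.+1.
Proof. by move=> hn; rewrite mulr_gt0 ?hmu // ltr0n; have := hs hn; lia. Qed.

Lemma gfac_gt0 n m : (1 <= n <= J)%N -> 0 < eta net n -> 0 < gfac net n m.
Proof.
move=> hn eta_gt0; rewrite /gfac big_add1 /= prodr_gt0 // => k _.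
by rewrite divr_gt0 ?mu_gt0.
Qed.

Lemma gfac_rec n m : (1 <= n <= J)%N ->
  gfac net n m.+1 * mu net n m.+1 = eta net n * gfac net n m.
Proof.
move=> hn; rewrite /gfac big_nat_recr //= -mulrA divfK ?(mulrC (eta _ _)) //.
by rewrite lt0r_neq0 ?mu_gt0.
Qed.

Lemma dto_ge0 n : 0 <= dto net x n. Proof. exact: hd0. Qed.

Lemma service_rate0 i : srv i 0 = 0.
Proof. by case: i => [|j|j|j] /=; rewrite ?/mu ?min0n ?mulr0 ?mul0r. Qed.

(** The inverse of 0 is 0, so no jump leaves an instantaneous node at positive rate. *)
Lemma service_rate_inst i m : inst i -> srv i m = 0.
Proof. by case: i => [|j|j|j] //= /eqP->; rewrite mul0r invr0 mulr0. Qed.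

Lemma service_rate_ge0 i m : 0 <= srv i m.
Proof.
have [->|m_gt0] := posnP m; first by rewrite service_rate0.
case: i => [|j|j|j] /=; rewrite ?divr_ge0 ?dto_ge0 ?ler0n ?(ltW hspeed) //.
  by rewrite -(prednK m_gt0) ltW // mu_gt0 //= ltnW.
by rewrite -(prednK m_gt0) ltW // mu_gt0 // station_range.
Qed.

Lemma service_rate_gt0 i m : ~~ inst i -> (0 < m)%N -> 0 < srv i m.
Proof.
have dto_gt0 j : dto net x j.+2 != 0 -> 0 < dto net x j.+2.
  by move=> d_neq0; rewrite lt0r d_neq0 dto_ge0.
case: m => // m; case: i => [|j|j|j] //= ij _.
- by rewrite mu_gt0 //= ltnW.
- by rewrite mu_gt0 // station_range.
- by rewrite !divr_gt0 ?dto_gt0.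
by rewrite !divr_gt0 ?dto_gt0.
Qed.

(** Local balance of a single node. It fails at an instantaneous node for [m = 0], where the rate is
    0 but the right-hand side is positive. *)
Lemma weight_rec i m : ~~ inst i ->
  weight i m.+1 * srv i m.+1 = visit_ratio i * weight i m.
Proof.
have travel (e d : R) : d != 0 ->
    (e * d / speed) ^+ m.+1 / m.+1`!%:R * (m.+1%:R / (d / speed)) =
    e * ((e * d / speed) ^+ m / m`!%:R).
  move=> d_neq0; rewrite exprS factS natrM; field => /=.
  have fact_neq0 : m`!%:R != 0 :> R by rewrite pnatr_eq0 -lt0n fact_gt0.
  by rewrite d_neq0 fact_neq0 nat1r pnatr_eq0 (lt0r_neq0 hspeed).
case: i => [|j|j|j] /= hi; rewrite ?travel //; apply: gfac_rec.
- by rewrite /= ltnW.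
- exact: station_range.
Qed.

Lemma weight_ge0 i m : 0 <= weight i m.
Proof.
have travel_ge0 j : 0 <= (eta net j.+2 * dto net x j.+2 / speed) ^+ m / m`!%:R.
  rewrite divr_ge0 ?ler0n // exprn_ge0 //; apply: divr_ge0 (ltW hspeed).
  by apply: mulr_ge0 (dto_ge0 _); exact: ltW (visit_ratio_gt0 (Warehouse j)).
case: i => [|j|j|j] //=.
- by rewrite ltW // gfac_gt0 ?(visit_ratio_gt0 Center) //= ltnW.
- by rewrite ltW // gfac_gt0 ?station_range // (visit_ratio_gt0 (Warehouse j)).
Qed.

Lemma weight_inst_eq0 i m : inst i -> (0 < m)%N -> weight i m = 0.
Proof.
by case: m => // m; case: i => [|j|j|j] //= /eqP-> _; rewrite mulr0 mul0r exprS !mul0r.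
Qed.

Lemma weight0 i : weight i 0 = 1.
Proof. by case: i => [|j|j|j] /=; rewrite ?/gfac ?big_geq // expr0 divr1. Qed.

Lemma weight_gt0 i m : ~~ inst i -> 0 < weight i m.
Proof.
move=> hi; elim: m => [|m IH]; first by rewrite weight0.
rewrite lt0r weight_ge0 andbT; apply/eqP => w0.
by have := mulr_gt0 (visit_ratio_gt0 i) IH; rewrite -weight_rec // w0 mul0r ltxx.
Qed.

Lemma routing_ge0 i k : 0 <= routing i k.
Proof. by case: i k => [|j|j|j] [|k|k|k] //=; rewrite ltW ?rho_gt0. Qed.

Lemma sum_delta (F : 'I_J.-1 -> R) j : \sum_k F k * (k == j)%:R = F j.
Proof.
rewrite (bigD1 j) //= eqxx mulr1 big1 ?addr0 // => k /negPf->.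
by rewrite mulr0.
Qed.

Lemma sum_routing i : \sum_k routing i k = 1.
Proof.
have sum_delta1 j : \sum_k (j == k)%:R = 1 :> R.
  rewrite -[RHS](sum_delta (fun=> 1) j).
  by apply: eq_bigr => k _; rewrite mul1r eq_sym.
case: i => [|j|j|j]; rewrite big_node /= ?big_split /= ?sum_rho ?sum_delta1.
all: by rewrite ?big1 ?addr0 ?add0r.
Qed.

Lemma traffic k : \sum_i visit_ratio i * routing i k = visit_ratio k.
Proof.
have sum0 (F : 'I_J.-1 -> R) : \sum_j F j * 0 = 0 by rewrite -mulr_suml mulr0.
case: k => [|k|k|k]; rewrite big_node /= big_split /= ?sum0 ?mulr0 ?sum_delta.
- rewrite !add0r -mulr_suml mulr1 -[RHS]mulr1 -sum_rho mulr_sumr.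
  by apply: eq_bigr => j _; rewrite /eta.
- by rewrite !add0r addr0.
- by rewrite !addr0 /eta.
- by rewrite add0r !addr0.
Qed.

(** * Elimination of the instantaneous nodes *)

Lemma routing_inst i k : inst i -> inst k -> routing i k = 0.
Proof. by case: i k => [|j|j|j] [|k|k|k]. Qed.

Lemma eff_routing_ge0 i k : 0 <= eff i k.
Proof.
rewrite /eff_routing; case: ifP => // _; rewrite addr_ge0 ?routing_ge0 //.
by apply: sumr_ge0 => l _; rewrite mulr_ge0 ?routing_ge0.
Qed.

Lemma eff_routing_inst i k : inst k -> eff i k = 0.
Proof. by rewrite /eff_routing => ->. Qed.

Lemma eff_routing_ge i k : ~~ inst k -> routing i k <= eff i k.
Proof.
move=> /negPf hk; rewrite /eff_routing hk lerDl.
by apply: sumr_ge0 => l _; rewrite mulr_ge0 ?routing_ge0.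
Qed.

Lemma eff_routing_ge_via i l k : ~~ inst k -> inst l ->
  routing i l * routing l k <= eff i k.
Proof.
move=> /negPf hk hl; rewrite /eff_routing hk (bigD1 l) //= addrCA lerDl.
rewrite addr_ge0 ?routing_ge0 //.
by apply: sumr_ge0 => l' _; rewrite mulr_ge0 ?routing_ge0.
Qed.

Lemma sum_routing_inst l : inst l -> \sum_(k | ~~ inst k) routing l k = 1.
Proof.
move=> hl; rewrite -(sum_routing l) [RHS](bigID inst) /=.
rewrite [X in _ = X + _]big1 ?add0r // => k hk.
exact: routing_inst.
Qed.

(** What [i] sends into an instantaneous node is passed on entirely to nodes that can be
    occupied. *)
Lemma sum_eff_routing i : \sum_k eff i k = 1.
Proof.
rewrite (bigID inst) /= big1 ?add0r => [|k]; last exact: eff_routing_inst.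
rewrite -(sum_routing i) [RHS](bigID inst) /= addrC.
under eq_bigr => k /negPf hk do rewrite /eff_routing hk.
rewrite big_split exchange_big /=; congr (_ + _).
by apply: eq_bigr => l hl; rewrite -mulr_sumr sum_routing_inst ?mulr1.
Qed.

(** The traffic equation at each instantaneous node is substituted into the one at [k]. *)
Lemma eff_traffic k : ~~ inst k ->
  \sum_(i | ~~ inst i) visit_ratio i * eff i k = visit_ratio k.
Proof.
move=> hk; under eq_bigr do rewrite /eff_routing (negPf hk) mulrDr mulr_sumr.
rewrite big_split exchange_big /= -[RHS]traffic [RHS](bigID inst) /= addrC.
congr (_ + _); apply: eq_bigr => l hl.
under eq_bigr do rewrite mulrA.
(* No predecessor of [l] is instantaneous, so the restricted sum is the full traffic equation at
   [l]. *)
rewrite -mulr_suml -[in RHS](traffic l) [in RHS](bigID inst) /= [X in X + _]big1.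
  by rewrite add0r.
by move=> i hi; rewrite routing_inst ?mulr0.
Qed.

(* A route is a cycle through the center, so predecessors eventually reach every
   node; eff skips the instantaneous nodes in between. *)
Lemma route_backward_closed (Q : node J -> Prop) i k :
  (forall l l', ~~ inst l -> 0 < eff l l' -> Q l' -> Q l) ->
  ~~ inst i -> ~~ inst k -> Q i -> Q k.
Proof.
move=> Qback hi hk.
have eff_step l l' : ~~ inst l' -> 0 < routing l l' -> 0 < eff l l'.
  by move=> hl' r_gt0; apply: lt_le_trans r_gt0 (eff_routing_ge _ hl').
have eff_skip l l' l'' : ~~ inst l'' -> inst l' ->
    0 < routing l l' -> 0 < routing l' l'' -> 0 < eff l l''.
  move=> hl'' hl' r_gt0 r'_gt0.
  exact: lt_le_trans (mulr_gt0 r_gt0 r'_gt0) (eff_routing_ge_via _ hl'' hl').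
have rjj j : 0 < (j == j)%:R :> R by rewrite eqxx.
have out_center j : ~~ inst (Outward j) -> Q (Outward j) -> Q Center.
  by move=> hj; apply: Qback => //; apply: eff_step => //=; apply: rho_gt0.
have wh_center j : Q (Warehouse j) -> Q Center.
  (* An instantaneous outward node is skipped: the center then feeds the warehouse directly. *)
  have [hj|hj] := boolP (inst (Outward j)).
    apply: Qback => //; apply: (@eff_skip _ (Outward j)) => //=.
    exact: rho_gt0.
  move=> Qw; apply: out_center (hj) _; apply: Qback Qw => //.
  by apply: eff_step => //=.
have home_wh j : ~~ inst (Homeward j) -> Q (Homeward j) -> Q (Warehouse j).
  by move=> hj; apply: Qback => //; apply: eff_step => //=.
have center_home j : ~~ inst (Homeward j) -> Q Center -> Q (Homeward j).
  by move=> hj; apply: Qback => //; apply: eff_step => //=.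
have center_wh j : Q Center -> Q (Warehouse j).
  have [hj|hj] := boolP (inst (Homeward j)).
    apply: Qback => //; apply: (@eff_skip _ (Homeward j)) => //=.
  by move=> Qc; apply: home_wh (hj) _; apply: center_home.
have wh_out j : ~~ inst (Outward j) -> Q (Warehouse j) -> Q (Outward j).
  by move=> hj; apply: Qback => //; apply: eff_step => //=.
(* Every route passes through the center, so [Q] is carried from [i] to it and from there to [k]. *)
move=> Qi; have Qc : Q Center.
  case: i hi Qi => [|j|j|j] hi //; [exact: wh_center|exact: out_center|].
  by move=> Qj; apply: wh_center (home_wh _ hi Qj).
case: k hk => [|j|j|j] hk //; [exact: center_wh| |exact: center_home].
by apply: wh_out hk _; apply: center_wh.
Qed.

(** * Product form *)

Section Population.
Variable N : nat.
Implicit Types (n m : state J N).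

Definition feasible n := [forall i, inst i ==> (qlen n i == 0)%N].

Definition product_weight n : R := \prod_i weight i (qlen n i).

Lemma feasibleP n :
  reflect (forall i, (0 < qlen n i)%N -> ~~ inst i) (feasible n).
Proof.
apply: (iffP forallP) => [hn i n_i | hn i].
  by apply: contraL n_i => hi; have := hn i; rewrite hi /= => /eqP->.
by apply/implyP => hi; rewrite -leqn0 leqNgt; apply: contraL hi => /hn.
Qed.

Lemma product_weight_ge0 n : 0 <= product_weight n.
Proof. by apply: prodr_ge0 => i _; apply: weight_ge0. Qed.

Lemma product_weight_gt0 n : feasible n -> 0 < product_weight n.
Proof.
move=> /feasibleP hn; apply: prodr_gt0 => i _.
by have [->|/hn hi] := posnP (qlen n i); rewrite ?weight0 ?weight_gt0.
Qed.

Lemma product_weight_inst n i :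
  inst i -> (0 < qlen n i)%N -> product_weight n = 0.
Proof.
by move=> hi n_i; rewrite /product_weight (bigD1 i) //= weight_inst_eq0 ?mul0r.
Qed.

(* Both sides are the weight of the N - 1 trucks that do not move, times the
   visit ratios of i and k. *)
Lemma product_weight_jump n i k n' :
  jump n i k n' -> ~~ inst i -> ~~ inst k ->
  product_weight n * srv i (qlen n i) * visit_ratio k =
  product_weight n' * srv k (qlen n' k) * visit_ratio i.
Proof.
have [<- /jumpnn-> //|ik nn' hi hk] := eqVneq i k.
have /jumpP[n_i E] := nn'.
have Ei : (qlen n i = (qlen n' i).+1)%N.
  by have := E i; rewrite eqxx (negPf ik) addn0 addn1.
have Ek : (qlen n' k = (qlen n k).+1)%N.
  by have := E k; rewrite eqxx eq_sym (negPf ik) addn0 addn1.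
have ki : k != i by rewrite eq_sym.
rewrite /product_weight !(bigD1 i (P := predT)) //.
rewrite !(bigD1 k (P := fun l => l != i)) //= Ei Ek.
rewrite (eq_bigr (fun l => weight l (qlen n' l))); last first.
  by move=> l /andP[/negPf li /negPf lk]; have := E l; rewrite li lk !addn0 => ->.
set P := \prod_(_ | _) _.
transitivity (weight i (qlen n' i).+1 * srv i (qlen n' i).+1
              * (visit_ratio k * weight k (qlen n k)) * P); first by ring.
by rewrite weight_rec // -(weight_rec _ hk); ring.
Qed.

(** Routing probabilities sum to 1; at an empty node no jump exists, but its rate is 0 as well. *)
Lemma sum_jump_rate n : \sum_n' jump_rate x speed n n' = \sum_i srv i (qlen n i).
Proof.
rewrite /jump_rate exchange_big /=; apply: eq_bigr => i _.
rewrite (exchange_big_dep predT) //= -[RHS]mulr1 -(sum_eff_routing i) mulr_sumr.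
apply: eq_bigr => k _; rewrite sum_jump.
by have [->|_] := posnP (qlen n i); rewrite ?service_rate0 ?mul0r.
Qed.

(** Partial balance: for each node [k] separately, the flow into [n'] by arrivals at [k] equals the
    flow out by service at [k]. *)
Lemma product_weight_balance n' :
  \sum_n product_weight n * jump_rate x speed n n' =
  product_weight n' * \sum_i srv i (qlen n' i).
Proof.
have -> : \sum_n product_weight n * jump_rate x speed n n' =
    \sum_k \sum_i \sum_(n | jump n' k i n)
      product_weight n * (srv i (qlen n i) * eff i k).
  rewrite [RHS]exchange_big /=.
  under [RHS]eq_bigr do rewrite (exchange_big_dep predT) //=.
  rewrite [RHS]exchange_big /=; apply: eq_bigr => n _.
  rewrite mulr_sumr; apply: eq_bigr => i _.
  by rewrite mulr_sumr; apply: eq_bigl => k; rewrite jump_sym.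
rewrite mulr_sumr; apply: eq_bigr => k _.
have [hk|hk] := boolP (inst k).
  rewrite service_rate_inst // mulr0 big1 // => i _.
  by rewrite big1 // => n _; rewrite eff_routing_inst // !mulr0.
(* Arrivals at [k] from [i] contribute [c * (visit_ratio i * eff i k)], and [eff_traffic] sums these
   over [i]. *)
pose c := product_weight n' * srv k (qlen n' k) / visit_ratio k.
rewrite -[RHS](divfK (lt0r_neq0 (visit_ratio_gt0 k))) -/c.
rewrite -[in RHS](eff_traffic hk) mulr_sumr (bigID inst) /= big1 ?add0r.
  apply: eq_bigr => i hi.
  rewrite (eq_bigr (fun=> c * (visit_ratio i * eff i k))) => [|n]; last first.
    rewrite jump_sym => nn'; rewrite !mulrA; congr (_ * _).
    rewrite /c mulrAC -(product_weight_jump nn' hi hk) mulfK //.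
    by rewrite lt0r_neq0 ?visit_ratio_gt0.
  (* If [k] is empty in [n'], there is no predecessor state, but then [c = 0]. *)
  rewrite sum_jump; have [n'k|//] := posnP (qlen n' k).
  by rewrite /c n'k service_rate0 mulr0 !mul0r.
by move=> i hi; rewrite big1 // => n _; rewrite service_rate_inst // mul0r mulr0.
Qed.

(** Inflow minus outflow. The rate from [n'] to itself occurs in both terms and cancels. *)
Lemma sum_generator (p : state J N -> R) n' :
  \sum_n p n * generator x speed n n' =
  \sum_n p n * jump_rate x speed n n' - p n' * \sum_i srv i (qlen n' i).
Proof.
rewrite (bigD1 n') //= [X in _ = X - _](bigD1 n') //=.
have -> : \sum_(n | n != n') p n * generator x speed n n' =
          \sum_(n | n != n') p n * jump_rate x speed n n'.
  by apply: eq_bigr => n /negPf nn'; rewrite /generator nn'.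
rewrite /generator eqxx -sum_jump_rate [X in _ - _ * X](bigD1 n') //=.
by ring.
Qed.

Lemma product_weight_generator n' :
  \sum_n product_weight n * generator x speed n n' = 0.
Proof. by rewrite sum_generator product_weight_balance subrr. Qed.

(** The center is never instantaneous, so this state is feasible; it is the reference state for
    positivity and for uniqueness. *)
Lemma state_at_center_exists : exists n : state J N, qlen n Center = N.
Proof.
have [|n nE] := @state_exists J N (fun i => if i == Center then N else 0%N).
  by rewrite -big_mkcond big_pred1_eq.
by exists n; rewrite nE eqxx.
Qed.

Lemma qlen_at_center n i : qlen n Center = N -> i != Center -> qlen n i = 0%N.
Proof.
move=> nN iC; have := sum_qlen n; rewrite (bigD1 Center) //= nN (bigD1 i) //=.
by lia.
Qed.

Definition partition_fun : R := \sum_n product_weight n.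

Lemma partition_fun_gt0 : 0 < partition_fun.
Proof.
have [n nN] := state_at_center_exists.
rewrite /partition_fun (bigD1 n) //= ltr_pwDl ?sumr_ge0 //.
  apply: product_weight_gt0; apply/feasibleP => i.
  by have [->//|/(qlen_at_center nN)->] := eqVneq i Center.
by move=> n' _; apply: product_weight_ge0.
Qed.

Lemma product_form_stationary :
  stationary x speed [ffun n : state J N => product_weight n / partition_fun].
Proof.
split=> [n||n i hi n_i|n'].
- by rewrite ffunE divr_ge0 ?product_weight_ge0 ?ltW ?partition_fun_gt0.
- under eq_bigr do rewrite ffunE.
  by rewrite -mulr_suml divff ?lt0r_neq0 ?partition_fun_gt0.
- by rewrite ffunE (product_weight_inst hi n_i) mul0r.
under eq_bigr do rewrite ffunE mulrAC.
by rewrite -mulr_suml product_weight_generator mul0r.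
Qed.

Lemma jump_rate_gt0 n i k n' : jump n i k n' -> ~~ inst i -> 0 < eff i k ->
  0 < jump_rate x speed n n'.
Proof.
move=> nn' hi eff_gt0; have /jumpP[n_i _] := nn'.
rewrite /jump_rate (bigD1 i) //= (bigD1 k) //= -addrA.
rewrite ltr_pwDl ?mulr_gt0 ?service_rate_gt0 // addr_ge0 ?sumr_ge0 //.
  by move=> k' _; rewrite mulr_ge0 ?service_rate_ge0 ?eff_routing_ge0.
move=> i' _; apply: sumr_ge0 => k' _.
by rewrite mulr_ge0 ?service_rate_ge0 ?eff_routing_ge0.
Qed.

Lemma jump_rate_ge0 n n' : 0 <= jump_rate x speed n n'.
Proof.
apply: sumr_ge0 => i _; apply: sumr_ge0 => k _.
by rewrite mulr_ge0 ?service_rate_ge0 ?eff_routing_ge0.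
Qed.

(** * Zeros of nonnegative balanced functions *)

Section BalancedFunction.
Variable h : state J N -> R.
Hypotheses (h_ge0 : forall n, 0 <= h n)
  (h_bal : forall n', \sum_n h n * generator x speed n n' = 0).

(** At a zero the outflow vanishes, hence so does every term of the nonnegative inflow. *)
Lemma balanced_zero_back n i k n' :
  jump n i k n' -> ~~ inst i -> 0 < eff i k -> h n' = 0 -> h n = 0.
Proof.
move=> nn' hi eff_gt0 hn'.
have := h_bal n'; rewrite sum_generator hn' mul0r subr0 => /psumr_eq0P sum0.
have /eqP : h n * jump_rate x speed n n' = 0.
  by apply: sum0 => // m _; rewrite mulr_ge0 ?jump_rate_ge0.
by rewrite mulf_eq0 [X in _ || X]gt_eqF ?orbF ?(jump_rate_gt0 nn') // => /eqP.
Qed.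

Lemma balanced_zero_move n i k n' :
  jump n i k n' -> ~~ inst i -> ~~ inst k -> h n = 0 -> h n' = 0.
Proof.
move=> nn' hi hk hn; have /jumpP[n_i _] := nn'.
(* [Q l] says that [h] vanishes once a truck has gone from [i] to [l]. [Q i] is the hypothesis on
   [n], and zeros spread backwards along routes. *)
pose Q l := forall m, jump n i l m -> h m = 0.
suff: Q k by apply.
apply: (route_backward_closed _ hi hk) => [l l' hl eff_gt0 Ql' m nm|m /jumpnn <- //].
have [m' nm'] := jump_exists l' n_i.
apply: (balanced_zero_back _ hl eff_gt0 (Ql' m' nm')).
move: nm nm' => /jumpP[_ E] /jumpP[_ E'].
apply/jumpP; split=> [|u]; last by have := E u; have := E' u; lia.
by have := E l; rewrite eqxx; case: eqP => [->|_]; lia.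
Qed.

(** Induction on the number of trucks away from the center: each is moved there by one jump, which
    can also be reversed. *)
Lemma balanced_zero_center n n1 : feasible n -> qlen n1 Center = N ->
  h n = 0 <-> h n1 = 0.
Proof.
move=> hn n1N; have [d] := ubnP (N - qlen n Center)%N.
elim: d => // d IH in n hn *; rewrite ltnS => led.
have leN : (qlen n Center <= N)%N.
  by rewrite -[X in (_ <= X)%N](sum_qlen n) (bigD1 Center) //= leq_addr.
have [nN|nN] := eqVneq (qlen n Center) N.
  suff -> : n = n1 by [].
  apply: qlen_inj => i; have [->|iC] := eqVneq i Center; first by rewrite nN n1N.
  by rewrite (qlen_at_center nN iC) (qlen_at_center n1N iC).
have [i iC n_i] : exists2 i, i != Center & (0 < qlen n i)%N.
  apply/exists_inP; apply: contraNT nN => /exists_inPn n0.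
  rewrite -[X in _ == X](sum_qlen n) (bigD1 Center) //= big1 ?addn0 // => i iC.
  by apply/eqP; rewrite -leqn0 leqNgt n0.
have [m nm] := jump_exists Center n_i.
have hi : ~~ inst i by apply: (feasibleP _ hn).
have /jumpP[_ E] := nm.
have mC : qlen m Center = (qlen n Center).+1.
  by have := E Center; rewrite eqxx eq_sym (negPf iC); lia.
have hm : feasible m.
  apply/feasibleP => l; have := E l; case: (eqVneq l Center) => [-> //|lC] El m_l.
  by apply: (feasibleP _ hn); lia.
have ltd : (N - qlen m Center < d)%N by move/eqP: nN; lia.
have <- := IH m hm ltd; split; first exact: (balanced_zero_move nm).
by rewrite jump_sym in nm; exact: (balanced_zero_move nm).
Qed.

Lemma balanced_zero n n' : feasible n -> feasible n' -> h n = 0 -> h n' = 0.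
Proof.
have [n1 n1N] := state_at_center_exists.
by move=> hn hn' /(balanced_zero_center hn n1N)/(balanced_zero_center hn' n1N).
Qed.

End BalancedFunction.

(* Subtracting from p the largest multiple c q of the product form that keeps
   the difference nonnegative gives a balanced function with a zero. *)
Lemma stationary_unique (p : {ffun state J N -> R}) : stationary x speed p ->
  p = [ffun n => product_weight n / partition_fun].
Proof.
move=> [p_ge0 p_sum p_inst p_bal].
have [n1 n1N] := state_at_center_exists.
have hn1 : feasible n1.
  apply/feasibleP => i.
  by have [->//|/(qlen_at_center n1N)->] := eqVneq i Center.
have infeasible0 n : ~~ feasible n -> p n = 0 /\ product_weight n = 0.
  move=> /forallPn[i]; rewrite negb_imply -lt0n => /andP[hi n_i].
  by rewrite (p_inst n i) // (product_weight_inst hi n_i).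
(* Infeasible states are left out, as their weight is 0. *)
have [n0 hn0 n0_min] := @Order.TotalTheory.arg_minP _ _ _ n1 feasible
  (fun n => p n / product_weight n) hn1.
pose c := p n0 / product_weight n0.
pose h n := p n - c * product_weight n.
have h_ge0 n : 0 <= h n.
  have [hn|/infeasible0[pn wn]] := boolP (feasible n); last first.
    by rewrite /h pn wn mulr0 subrr.
  by rewrite subr_ge0 -ler_pdivlMr ?product_weight_gt0 // n0_min.
have h_bal n' : \sum_n h n * generator x speed n n' = 0.
  under eq_bigr do rewrite mulrBl -mulrA.
  by rewrite sumrB -mulr_sumr p_bal product_weight_generator mulr0 subrr.
have h_n0 : h n0 = 0 by rewrite /h divfK ?subrr // lt0r_neq0 ?product_weight_gt0.
have pE n : p n = c * product_weight n.
  have [hn|/infeasible0[-> ->]] := boolP (feasible n); last by rewrite mulr0.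
  by apply/eqP; rewrite -subr_eq0; apply/eqP/(balanced_zero h_ge0 h_bal hn0 hn h_n0).
(* Total mass 1 determines [c]. *)
have cE : c = partition_fun^-1.
  have := p_sum; under eq_bigr do rewrite pE.
  rewrite -mulr_sumr => /(congr1 (fun z => z / partition_fun)).
  by rewrite mulfK ?mul1r ?lt0r_neq0 ?partition_fun_gt0.
by apply/ffunP => n; rewrite ffunE pE cE mulrC.
Qed.

(** Existence rules out the default value of [xget]; uniqueness identifies its choice. *)
Lemma stationary_distE n :
  stationary_dist net x speed N n = product_weight n / partition_fun.
Proof.
rewrite /stationary_dist.
rewrite (@xget_unique _ _ _ _ product_form_stationary) ?ffunE // => p.
exact: stationary_unique.
Qed.

End Population.

(** * Throughput and correctness of the algorithm *)

(** The value that step (2) of the algorithm computes for [m] trucks once the first column is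
    filled. *)
Definition norm_const m : R :=
  \sum_(n < m.+1) Gcol net (gfac net 1) J (m - n) * (kappa net x speed ^+ n / n`!%:R).

Lemma coef_prod_weight L m : (m < L)%N ->
  (\prod_i \poly_(l < L) weight i l)`_m = norm_const m.
Proof.
move=> ltmL; rewrite big_node /=.
rewrite -(big_warehouse _ (fun j : nat => \poly_(l < L) gfac net j l)).
(* The center joins as factor number 1, so that the product starts at 1. *)
rewrite -big_ltn; last by lia.
(* Outward and homeward nodes form one family, whose parameters add up to [kappa]; hence its factor
   2. *)
have -> : \prod_j (\poly_(l < L) weight (Outward j) l
                   * \poly_(l < L) weight (Homeward j) l) =
    \prod_(i : 'I_J.-1 + 'I_J.-1)
      \poly_(l < L) ((match i with inl j | inr j =>
          eta net j.+2 * dto net x j.+2 / speed end) ^+ l / l`!%:R).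
  by rewrite big_sumType big_split.
rewrite coefMr /norm_const; apply: eq_bigr => n _.
have lenm : (n <= m)%N by rewrite -ltnS.
rewrite coef_prod_exp_poly ?(leq_ltn_trans lenm) //.
have := @coef_prod_gfac R net J.-1 L (m - n).
rewrite prednK; last by lia.
move=> ->; last by lia.
congr (_ * (_ ^+ _ / _)); rewrite big_sumType /= /kappa mulr2n.
by rewrite big_warehouse mulrDl !mul1r.
Qed.

Lemma partition_funE N : partition_fun N = norm_const N.
Proof.
rewrite -(@coef_prod_weight N.+1) // coef_prod_poly /partition_fun.
by rewrite -(sum_state (fun f : {ffun node J -> 'I_N.+1} => \prod_i weight i (f i))).
Qed.

(* w_j(m) mu_j(m) = eta_j w_j(m-1), so inserting mu_j multiplies the generating
   polynomial by eta_j X up to a term of too high degree. *)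
Lemma sum_weight_mu N j :
  \sum_n product_weight n * mu net j.+2 (@qlen _ N.+1 n (Warehouse j)) =
  eta net j.+2 * norm_const N.
Proof.
(* Inserting the rate of warehouse [j] into its own factor makes the sum a coefficient again. *)
pose w i (l : nat) :=
  if i == Warehouse j then weight i l * mu net j.+2 l else weight i l.
transitivity (\sum_(n : state J N.+1) \prod_i w i (val n i)).
  apply: eq_bigr => n _.
  rewrite /product_weight !(bigD1 (Warehouse j) (P := predT)) //=.
  rewrite [w (Warehouse j) _]/w eqxx mulrAC; congr (_ * _).
  by apply: eq_bigr => i /negPf hi; rewrite /w hi.
rewrite (sum_state (fun f : {ffun node J -> 'I_N.+2} => \prod_i w i (f i))).
rewrite -coef_prod_poly -(@coef_prod_weight N.+2) //.
rewrite !(bigD1 (Warehouse j) (P := predT)) //=.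
have -> : \prod_(i | i != Warehouse j) \poly_(l < N.+2) w i l =
          \prod_(i | i != Warehouse j) \poly_(l < N.+2) weight i l.
  by apply: eq_bigr => i /negPf hi; apply: eq_poly => l _; rewrite /w hi.
set Q := \prod_(_ | _) _; set A := \poly_(l < N.+2) gfac net j.+2 l.
(* The top term of [A] is removed before the shift, which would push it beyond the truncation. *)
have -> : \poly_(l < N.+2) w (Warehouse j) l =
    eta net j.+2 *: ('X * (A - gfac net j.+2 N.+1 *: 'X^(N.+1))).
  apply/polyP => l; rewrite coefZ coefXM coefB coefZ coefXn !coef_poly /w eqxx.
  (* The constant term vanishes because an empty warehouse has rate 0. *)
  case: l => [|l] /=; first by rewrite /mu min0n !mulr0.
  rewrite ltnS gfac_rec ?station_range // [(l < N.+2)%N]ltnS.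
  by case: ltngtP => [||->]; rewrite ?mulr1 ?mulr0 ?subr0 ?subrr ?mulr0.
(* The removed term has degree [N.+1] and does not reach the coefficient [N] that is left. *)
rewrite -scalerAl coefZ -['X * _ * _]mulrA coefXM /= mulrBl coefB.
rewrite -scalerAl coefZ coefXnM.
by rewrite ltnS leqnn mulr0 subr0.
Qed.

(** The factor [4^-1] is the total visit ratio of the warehouses. *)
Lemma throughputE N :
  throughput net x speed N.+1 = 4^-1 * (norm_const N / norm_const N.+1).
Proof.
rewrite /throughput.
under eq_bigr => j _.
  under eq_bigr do rewrite stationary_distE mulrAC partition_funE.
  rewrite -mulr_suml sum_weight_mu.
  over.
rewrite -!mulr_suml -mulrA; congr (_ * _).
transitivity (\sum_(j < J.-1) 4^-1 * rho net j.+2); first exact: eq_bigr.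
by rewrite -mulr_sumr sum_rho mulr1.
Qed.

(** An entry in row [m] reads the first column only up to [m], so a partly filled memory
    suffices. *)
Lemma Gcol_eq (G1 G2 : nat -> R) (k m : nat) :
  (forall l : nat, (l <= m)%N -> G1 l = G2 l) -> Gcol net G1 k m = Gcol net G2 k m.
Proof.
elim: k m => [|[|k] IH] m eqG; [exact: eqG | exact: eqG |].
apply: eq_bigr => l _; congr (_ * _); apply: IH => l' le_l'.
by apply: eqG; rewrite (leq_trans le_l') // -ltnS.
Qed.

(* H is shifted by one: H(n) holds the normalizing constant for n - 1 trucks. *)
Definition memory_spec (st : memory) : Prop :=
  [/\ (0 < curN st)%N,
      forall m, (m < curN st)%N -> memG1 st m = gfac net 1 m
    & memH st (curN st) = norm_const (curN st).-1].

Lemma init_memory_spec : memory_spec init_memory.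
Proof.
split=> //= [m|]; first by rewrite ltnS leqn0 => /eqP->; rewrite /gfac big_geq.
(* [H(1)] is the normalizing constant for no trucks: every factor has constant coefficient 1. *)
have := @coef_prod_weight 1 0 isT; rewrite coef0_prod => <-.
by rewrite big1 // => i _; rewrite coef_poly /= weight0.
Qed.

(** [throughputE] identifies the two tests; the stored [Gbar] is the value of [memH] that the next
    iteration reads. *)
Lemma step_spec C st : memory_spec st ->
  if total_demand net <= C * throughput net x speed (curN st)
  then step net x speed C st = inl (curN st)
  else exists st', [/\ step net x speed C st = inr st',
                       curN st' = (curN st).+1 & memory_spec st'].
Proof.
case: st => -[|N] G1 H [//= _ G1E HE].
have G1E' m : (m <= N.+1)%N -> [eta G1 with N.+1 |-> gfac net 1 N.+1] m = gfac net 1 m.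
  by rewrite /= leq_eqVlt; case: eqP => [->|_] //=; exact: G1E.
have normE : \sum_(n < N.+2)
     Gcol net [eta G1 with N.+1 |-> gfac net 1 N.+1] J (N.+1 - n) *
     (kappa net x speed ^+ n / n`!%:R) = norm_const N.+1.
  apply: eq_bigr => n _; congr (_ * _); apply: Gcol_eq => l le_l.
  by apply: G1E'; rewrite (leq_trans le_l) ?leq_subr.
rewrite throughputE [C * _]mulrA /step /= normE HE.
case: (total_demand net <= _) => //; eexists; split=> //; split=> //=.
by rewrite eqxx.
Qed.

(** Each iteration tests one value, from [curN st] to [N] inclusive, whence the successor in the
    number of iterations. *)
Lemma run_spec C st N : memory_spec st -> (curN st <= N)%N ->
  total_demand net <= C * throughput net x speed N ->
  (forall m, (curN st <= m < N)%N ->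
     ~~ (total_demand net <= C * throughput net x speed m)) ->
  run net x speed C (N - curN st).+1 st = Some N.
Proof.
move=> stP leN hN hmin; move dE: (N - curN st)%N => d.
elim: d => [|d IH] in st stP leN hmin dE *; have := step_spec C stP.
  have -> : curN st = N by lia.
  by rewrite hN /= => ->.
have /negPf-> : ~~ (total_demand net <= C * throughput net x speed (curN st)).
  by apply: hmin; lia.
move=> [st' [stE NE st'P]]; rewrite [LHS]/= stE; apply: IH => //; rewrite ?NE; try lia.
by move=> m hm; apply: hmin; lia.
Qed.

End Network.

Theorem mainTheorem3 (R : realType) (net : network R) (x : 'rV[R]_2) (C speed : R)
    (hJ : (2 <= nstations net)%N)
    (hD : forall j : nat, (2 <= j <= nstations net)%N -> 0 < demand net j)
    (hd0 : forall a y : 'rV[R]_2, 0 <= dist net a y)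
    (hdconv : convex_function [set: 'rV[R]_2 * 'rV[R]_2]%classic
                (fun p : 'rV[R]_2 * 'rV[R]_2 => dist net p.1 p.2))
    (hs : forall j : nat, (1 <= j <= nstations net)%N -> (1 <= servers net j)%N)
    (hmu : forall j : nat, (1 <= j <= nstations net)%N -> 0 < srate net j)
    (hC : 0 < C) (hspeed : 0 < speed)
    (hfeas : exists N : nat,
       (1 <= N)%N /\ total_demand net <= C * throughput net x speed N) :
  exists k N : nat,
    [/\ run net x speed C k init_memory = Some N,
        (1 <= N)%N,
        total_demand net <= C * throughput net x speed N
      & forall M : nat, (1 <= M)%N ->
          total_demand net <= C * throughput net x speed M -> (N <= M)%N].
Proof.
pose suff_trucks N :=
  (1 <= N)%N && (total_demand net <= C * throughput net x speed N).
have exN : exists N, suff_trucks N.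
  by have [N [N_gt0 hN]] := hfeas; exists N; apply/andP.
have [N /andP[N_gt0 hN] minN] := ex_minnP exN.
have {}minN M : (1 <= M)%N -> total_demand net <= C * throughput net x speed M ->
    (N <= M)%N.
  by move=> M_gt0 hM; apply: minN; apply/andP.
(* The search starts at 1: [N - 1] tests fail, then one succeeds. *)
exists (N - 1).+1, N; split=> //.
apply: (run_spec hJ hD hd0 hs hmu hspeed) => //.
  exact: init_memory_spec.
move=> m /andP[m_gt0 ltmN]; apply: contraL ltmN => hm.
by rewrite -leqNgt minN.
Qed.
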